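(* Let $K$ be a field, $X$ a partially ordered set, and let $\Phi=\begin{bmatrix}\rho & 0\\ \phi_{21}&\phi_{22}\end{bmatrix}$ be an anti-automorphism of $D(X,K)$. Then $\Phi=\widetilde{\rho}\circ\widetilde{g}\circ\widetilde{D}$, where $\rho$ is an anti-automorphism of $FI(X,K)$ such that $\lambda_\Phi=\lambda_\rho=\lambda_{\widetilde{\rho}}$, $g$ is some central unit of $FI(X,K)$, and $D:FI(X,K)\to I(X,K)$ is some derivation. Moreover, if $\Phi$ is an involution on $D(X,K)$, then the same holds with $\rho$ an involution on $FI(X,K)$.
   Context: For a field $K$ and a poset $X$, the incidence space $I(X,K)$ is the $K$-space of functions $f:X\times X\to K$ with $f(x,y)=0$ whenever $x\nleq y$. The finitary incidence algebra $FI(X,K)$ is the subspace of all $f\in I(X,K)$ such that for all $x\le y$ in $X$ there are only finitely many subintervals $[u,v]\subseteq[x,y]$ with $u\ne v$ and $f(u,v)\neq 0$. It is an associative unital $K$-algebra under convolution $(fg)(x,y)=\sum_{x\le z\le y}f(x,z)g(z,y)$, and the same formula makes $I(X,K)$ an $FI(X,K)$-bimodule. $D(X,K)=FI(X,K)(+)I(X,K)$ is the $K$-algebra $FI(X,K)\oplus I(X,K)$, elements written as columns, with multiplication $\begin{bmatrix}f\\ i\end{bmatrix}\begin{bmatrix}g\\ j\end{bmatrix}=\begin{bmatrix}fg\\ fj+ig\end{bmatrix}$. All (anti-)automorphisms of algebras are $K$-linear; an involution is an anti-automorphism whose square is the identity. $K$-linear endomorphisms of $D(X,K)$ are written as $2\times2$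 matrices of $K$-linear maps acting on columns; every anti-automorphism of $D(X,K)$ has zero $(1,2)$ entry, i.e. zero component $I(X,K)\to FI(X,K)$. Let $e_x\in FI(X,K)$ be the function equal to $1$ at $(x,x)$ and $0$ elsewhere. For an anti-automorphism $\Phi$ of $D(X,K)$, $\lambda_\Phi$ denotes the anti-automorphism of the poset $X$ (order-reversing bijection with order-reversing inverse) induced by $\Phi$: for each $x\in X$, $\lambda_\Phi(x)$ is the unique element such that $\Phi\left(\begin{bmatrix}e_x\\0\end{bmatrix}\right)$ is conjugate (by a unit) to $\begin{bmatrix}e_{\lambda_\Phi(x)}\\0\end{bmatrix}$. For an anti-automorphism $\varphi$ of $FI(X,K)$, $\lambda_\varphi$ denotes the anti-automorphism of $X$ such that $\varphi(e_x)$ is conjugate to $e_{\lambda_\varphi(x)}$ for each $x\in X$. For an anti-automorphism $\rho$ of $FI(X,K)$, $\overline{\rho}:I(X,K)\to I(X,K)$ is the unique bijective additive extension of $\rho$ satisfying $\overline\rho(f\,i\,h)=\rho(h)\overline\rho(i)\rho(f)$ for all $f,h\in FI(X,K)$, $i\in I(X,K)$, and $\widetilde\rho=\begin{bmatrix}\rho&0\\0&\overline\rho\end{bmatrix}$, an anti-automorphism of $D(X,K)$. For a central unit $g$ of $FI(X,K)$, $\widetilde g\left(\begin{bmatrix}f\\ i\end{bmatrix}\right)=\begin{bmatrix}f\\ gi\end{bmatrix}$. A derivation $D:FI(X,K)\to I(X,K)$ is a $K$-linear map with $D(fh)=D(f)h+fD(h)$, and $\widetilde D\left(\begin{bmatrix}f\\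 i\end{bmatrix}\right)=\begin{bmatrix}f\\ D(f)+i\end{bmatrix}$. *)

(* Defs.v *)
From HB Require Import structures.
From mathcomp Require Import all_boot all_order all_algebra.
From mathcomp Require Import boolp classical_sets functions cardinality fsbigop.

Set Implicit Arguments.
Unset Strict Implicit.
Unset Printing Implicit Defensive.

Import Order.TTheory GRing.Theory.
Local Open Scope classical_set_scope.
Local Open Scope ring_scope.

(* The algebras FI(X,K) = fincidence K X and D(X,K) = idealization K X carry   *)
(* pzRingType and lmodType structures rather than an algType one, since an    *)
(* algType is nonzero and X may be empty; the remaining algebra axioms are    *)
(* the lemmas scale_fincidenceA* and scale_idealizationA*.                    *)

Section Incidence.
Context (K : fieldType) (d : Order.disp_t) (X : porderType d).

Definition incidence_pred : {pred X -> X -> K} :=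
  fun f => `[< forall x y, ~~ (x <= y)%O -> f x y = 0 >].

Lemma incidence_pred_closed : zmod_closed incidence_pred.
Proof.
split; first by apply/asboolP => x y _.
move=> f g /asboolP f0 /asboolP g0; apply/asboolP => x y nxy.
by rewrite -[LHS]/(f x y - g x y) f0 // g0 // subrr.
Qed.

Record incidence := Incidence {
  incidence_fun :> X -> X -> K;
  _ : incidence_fun \in incidence_pred }.

HB.instance Definition _ := [isSub for incidence_fun].
HB.instance Definition _ := [Choice of incidence by <:].
HB.instance Definition _ :=
  GRing.SubChoice_isSubZmodule.Build (X -> X -> K) incidence_pred incidence
    incidence_pred_closed.

Lemma incidence_out (f : incidence) x y : ~~ (x <= y)%O -> f x y = 0.
Proof. by case: f => f /= /asboolP; apply. Qed.

Lemma incidenceP (f g : incidence) : (forall x y, f x y = g x y) <-> f = g.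
Proof.
split=> [fg|->//]; apply: val_inj; apply/funext => x; apply/funext => y.
exact: fg.
Qed.

Lemma incidenceDE (f g : incidence) x y : (f + g) x y = f x y + g x y.
Proof. by []. Qed.

Lemma iscale_subproof (k : K) (f : incidence) :
  (fun x y => k * f x y) \in incidence_pred.
Proof. by apply/asboolP => x y /incidence_out ->; rewrite mulr0. Qed.

Definition iscale (k : K) (f : incidence) : incidence :=
  Incidence (iscale_subproof k f).

Lemma iscaleA a b f : iscale a (iscale b f) = iscale (a * b) f.
Proof. by apply/incidenceP => x y; exact: mulrA. Qed.

Lemma iscale1 : left_id 1 iscale.
Proof. by move=> f; apply/incidenceP => x y; exact: mul1r. Qed.

Lemma iscaleDr : right_distributive iscale +%R.
Proof. by move=> k f g; apply/incidenceP => x y; exact: mulrDr. Qed.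

Lemma iscaleDl f : {morph iscale^~ f : a b / a + b}.
Proof. by move=> a b; apply/incidenceP => x y; exact: mulrDl. Qed.

HB.instance Definition _ := GRing.Zmodule_isLmodule.Build K incidence
  iscaleA iscale1 iscaleDr iscaleDl.

Lemma incidenceZE k (f : incidence) x y : (k *: f) x y = k * f x y.
Proof. by []. Qed.

Lemma incidence0E x y : (0 : incidence) x y = 0.
Proof. by []. Qed.

Lemma incidence_in (f : incidence) x y : f x y != 0 -> (x <= y)%O.
Proof. by move=> fxy; apply: contraNT fxy => /incidence_out ->. Qed.

(* A finitely supported sum has its usual value; otherwise it is 0 by         *)
(* convention. The latter cannot happen when f or g is finitary.              *)
Definition conv_fun (f g : X -> X -> K) (x y : X) : K :=
  \sum_(z \in [set z | (x <= z <= y)%O]) f x z * g z y.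

Lemma conv_subproof (f g : X -> X -> K) : conv_fun f g \in incidence_pred.
Proof.
apply/asboolP => x y nxy; rewrite /conv_fun fsbig1 // => z /= /andP[xz zy].
by rewrite (le_trans xz zy) in nxy.
Qed.

Definition conv (f g : incidence) : incidence :=
  Incidence (conv_subproof f g).

Lemma convE (f g : incidence) x y :
  conv f g x y = \sum_(z \in [set: X]) f x z * g z y.
Proof.
apply: fsbig_widen => // z [_ /= nz].
apply/eqP; rewrite mulf_eq0; apply: contra_notT nz.
by rewrite negb_or => /andP[/incidence_in -> /incidence_in ->].
Qed.

Lemma conv_neq0 (f g : incidence) x y : conv f g x y != 0 ->
  exists2 z, f x z != 0 & g z y != 0.
Proof.
apply: contra_neqP => nfg; rewrite convE fsbig1 // => z _.
apply/eqP; rewrite mulf_eq0; apply: contra_notT nfg.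
by rewrite negb_or => /andP[fz gz]; exists z.
Qed.

(* The pairs (u, v) stand for the subintervals [u,v] of [x,y] with u != v.    *)
Definition off_diag (f : X -> X -> K) (x y : X) : set (X * X) :=
  [set p | [/\ (x <= p.1)%O, (p.1 < p.2)%O, (p.2 <= y)%O & f p.1 p.2 != 0]].

Definition finitary_pred : {pred incidence} :=
  fun f => `[< forall x y, (x <= y)%O -> finite_set (off_diag f x y) >].

Lemma finitary_pred_closed : subsemimod_closed finitary_pred.
Proof.
split; first split.
- apply/asboolP => x y _; apply: (@sub_finite_set _ _ set0) => // p.
  by case=> _ _ _; rewrite incidence0E eqxx.
- move=> f g /asboolP ff /asboolP fg; apply/asboolP => x y xy.
  apply: (@sub_finite_set _ _ (off_diag f x y `|` off_diag g x y)).
    move=> p [xp pp py]; rewrite incidenceDE => fgp.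
    case: (eqVneq (f p.1 p.2) 0) => [f0|fn0]; last by left.
    by right; split=> //; rewrite f0 add0r in fgp.
  by rewrite finite_setU; split; [exact: ff|exact: fg].
- move=> k f /asboolP ff; apply/asboolP => x y xy.
  apply: sub_finite_set (ff x y xy) => p [xp pp py].
  by rewrite incidenceZE mulf_eq0 negb_or => /andP[].
Qed.

Record fincidence := Fincidence {
  fincidence_val :> incidence;
  _ : fincidence_val \in finitary_pred }.

HB.instance Definition _ := [isSub for fincidence_val].
HB.instance Definition _ := [Choice of fincidence by <:].
HB.instance Definition _ :=
  GRing.SubChoice_isSubLmodule.Build K _ finitary_pred fincidence
    finitary_pred_closed.

Implicit Types (f g h : fincidence) (i j : incidence).

Lemma fincidence_finite f x y : (x <= y)%O -> finite_set (off_diag f x y).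
Proof. by case: f => f /= /asboolP; apply. Qed.

Lemma fincidenceP f g : (forall x y, f x y = g x y) <-> f = g.
Proof. by split=> [fg|->//]; apply: val_inj; apply/incidenceP. Qed.

Lemma fincidenceDE f g : (f + g : fincidence) = (f : incidence) + g :> incidence.
Proof. by []. Qed.

Lemma fincidenceZE (k : K) f : (k *: f : fincidence) = k *: (f : incidence) :> incidence.
Proof. by []. Qed.

Lemma finite_row f x y : finite_set [set z | (z <= y)%O /\ f x z != 0].
Proof.
have [xy|nxy] := boolP (x <= y)%O; last first.
  apply: (@sub_finite_set _ _ set0) => // z [zy /incidence_in xz].
  by rewrite (le_trans xz zy) in nxy.
apply: (@sub_finite_set _ _
  ([set x] `|` [set p.2 | p in off_diag f x y])).
  move=> z [zy fz]; case: (eqVneq z x) => [->|zx]; first by left.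
  by right; exists (x, z) => //; split=> //=; rewrite lt_def zx (incidence_in fz).
by rewrite finite_setU; split=> //; apply: finite_image; apply: fincidence_finite.
Qed.

Lemma finite_col f x y : finite_set [set z | (x <= z)%O /\ f z y != 0].
Proof.
have [xy|nxy] := boolP (x <= y)%O; last first.
  apply: (@sub_finite_set _ _ set0) => // z [xz /incidence_in zy].
  by rewrite (le_trans xz zy) in nxy.
apply: (@sub_finite_set _ _
  ([set y] `|` [set p.1 | p in off_diag f x y])).
  move=> z [xz fz]; case: (eqVneq y z) => [->|yz]; first by left.
  by right; exists (z, y) => //; split=> //=; rewrite lt_def yz (incidence_in fz).
by rewrite finite_setU; split=> //; apply: finite_image; apply: fincidence_finite.
Qed.

Lemma conv_assoc_fin (a b c : incidence) x y (W Z : set X) :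
  finite_set W -> finite_set Z ->
  (forall w z, a x w != 0 -> b w z != 0 -> c z y != 0 -> W w /\ Z z) ->
  conv a (conv b c) x y = conv (conv a b) c x y.
Proof.
move=> finW finZ WZ.
pose F w z := a x w * b w z * c z y.
have F0 w z : ~ (W w /\ Z z) -> F w z = 0.
  move=> nWZ; apply/eqP; apply: contra_notT nWZ.
  by rewrite /F !mulf_eq0 !negb_or -andbA => /and3P[*]; exact: WZ.
transitivity (\sum_(w \in W) \sum_(z \in Z) F w z).
  rewrite convE -(fsbig_widen W setT) //; last first.
    move=> w [_ nW]; change (a x w * conv b c w y = 0).
    rewrite convE mulr_fsumr fsbig1 // => z _.
    by rewrite mulrA -/(F w z) F0 // => -[].
  apply: eq_fsbigr => w /set_mem Ww; rewrite convE mulr_fsumr.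
  rewrite -(fsbig_widen Z setT) //; last first.
    by move=> z [_ nZ] /=; rewrite mulrA -/(F w z) F0 // => -[].
  by apply: eq_fsbigr => z _; rewrite mulrA.
rewrite exchange_fsbig // convE -[RHS](fsbig_widen Z setT) //; last first.
  move=> z [_ nZ]; change (conv a b x z * c z y = 0).
  rewrite convE mulr_fsuml fsbig1 // => w _.
  by rewrite -/(F w z) F0 // => -[].
apply: eq_fsbigr => z /set_mem Zz; rewrite convE mulr_fsuml.
rewrite -[RHS](fsbig_widen W setT) // => w [_ nW] /=.
by rewrite -/(F w z) F0 // => -[].
Qed.

Lemma conv_assoc_l f g i : conv f (conv g i) = conv (conv f g) i.
Proof.
apply/incidenceP => x y.
pose W := [set z | (z <= y)%O /\ f x z != 0].
pose Z := \bigcup_(w in W) [set z | (z <= y)%O /\ g w z != 0].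
apply: (@conv_assoc_fin f g i x y W Z); first exact: finite_row.
- by apply: bigcup_finite => [|w _]; exact: finite_row.
- move=> w z fw gz iz; have zy := incidence_in iz.
  have Ww : W w by split=> //; apply: le_trans zy; exact: incidence_in gz.
  by split=> //; exists w.
Qed.

Lemma conv_assoc_m f i g : conv f (conv i g) = conv (conv f i) g.
Proof.
apply/incidenceP => x y.
apply: (@conv_assoc_fin f i g x y [set z | (z <= y)%O /\ f x z != 0]
  [set z | (x <= z)%O /\ g z y != 0]); first exact: finite_row.
- exact: finite_col.
- move=> w z fw iz gz.
  have xw := incidence_in fw; have wz := incidence_in iz.
  have zy := incidence_in gz.
  by split; split=> //; [exact: le_trans wz zy|exact: le_trans xw wz].
Qed.

Lemma conv_assoc_r i f g : conv i (conv f g) = conv (conv i f) g.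
Proof.
apply/incidenceP => x y.
pose Z := [set z | (x <= z)%O /\ g z y != 0].
pose W := \bigcup_(z in Z) [set w | (x <= w)%O /\ f w z != 0].
apply: (@conv_assoc_fin i f g x y W Z).
- by apply: bigcup_finite => [|w _]; exact: finite_col.
- exact: finite_col.
- move=> w z iw fz gz; have xw := incidence_in iw.
  have Zz : Z z by split=> //; apply: le_trans xw _; exact: incidence_in fz.
  by split=> //; exists z.
Qed.

Lemma convZl (k : K) i j : conv (k *: i) j = k *: conv i j.
Proof.
apply/incidenceP => x y; rewrite incidenceZE !convE mulr_fsumr.
by apply: eq_fsbigr => z _; rewrite incidenceZE mulrA.
Qed.

Lemma convZr (k : K) i j : conv i (k *: j) = k *: conv i j.
Proof.
apply/incidenceP => x y; rewrite incidenceZE !convE mulr_fsumr.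
by apply: eq_fsbigr => z _; rewrite incidenceZE mulrCA.
Qed.

Lemma conv_row_sum f i x y :
  conv f i x y = \sum_(z \in [set z | (z <= y)%O /\ f x z != 0]) f x z * i z y.
Proof.
rewrite convE; apply/esym/fsbig_widen => // z [_ /= nz].
apply/eqP; rewrite mulf_eq0; apply: contra_notT nz.
by rewrite negb_or => /andP[-> /incidence_in].
Qed.

Lemma conv_col_sum f i x y :
  conv i f x y = \sum_(z \in [set z | (x <= z)%O /\ f z y != 0]) i x z * f z y.
Proof.
rewrite convE; apply/esym/fsbig_widen => // z [_ /= nz].
apply/eqP; rewrite mulf_eq0; apply: contra_notT nz.
by rewrite negb_or => /andP[/incidence_in -> ->].
Qed.

Lemma convDr_l f i j : conv f (i + j) = conv f i + conv f j.
Proof.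
apply/incidenceP => x y; rewrite incidenceDE !conv_row_sum.
rewrite !fsbig_finite /=; try exact: finite_row.
by rewrite -big_split /=; apply: eq_bigr => z _; rewrite -mulrDr.
Qed.

Lemma convDl_r f i j : conv (i + j) f = conv i f + conv j f.
Proof.
apply/incidenceP => x y; rewrite incidenceDE !conv_col_sum.
rewrite !fsbig_finite /=; try exact: finite_col.
by rewrite -big_split /=; apply: eq_bigr => z _; rewrite -mulrDl.
Qed.

Lemma conv_sub_row f i x y (S : set X) : finite_set S ->
    [set z | (z <= y)%O /\ f x z != 0] `<=` S ->
  conv f i x y = \sum_(z \in S) f x z * i z y.
Proof.
move=> finS sS; rewrite conv_row_sum; apply: fsbig_widen => // z [_ /= nz].
apply/eqP; rewrite mulf_eq0; apply: contra_notT nz.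
by rewrite negb_or => /andP[-> /incidence_in].
Qed.

Lemma convDl_l f g i : conv (f + g) i = conv f i + conv g i.
Proof.
apply/incidenceP => x y; rewrite incidenceDE.
pose S := [set z | (z <= y)%O /\ f x z != 0] `|`
          [set z | (z <= y)%O /\ g x z != 0].
have finS : finite_set S by rewrite finite_setU; split; exact: finite_row.
rewrite !(@conv_sub_row _ _ _ _ S) //.
- rewrite !fsbig_finite //= -big_split /=; apply: eq_bigr => z _.
  by rewrite -mulrDl.
- by move=> z ?; right.
- by move=> z ?; left.
- move=> z [zy]; rewrite fincidenceDE incidenceDE => fgz.
  case: (eqVneq (f x z) 0) => [f0|fn0]; last by left.
  by right; split=> //; rewrite f0 add0r in fgz.
Qed.

Lemma conv_sub_col f i x y (S : set X) : finite_set S ->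
    [set z | (x <= z)%O /\ f z y != 0] `<=` S ->
  conv i f x y = \sum_(z \in S) i x z * f z y.
Proof.
move=> finS sS; rewrite conv_col_sum; apply: fsbig_widen => // z [_ /= nz].
apply/eqP; rewrite mulf_eq0; apply: contra_notT nz.
by rewrite negb_or => /andP[/incidence_in -> ->].
Qed.

Lemma convDr_r i f g : conv i (f + g) = conv i f + conv i g.
Proof.
apply/incidenceP => x y; rewrite incidenceDE.
pose S := [set z | (x <= z)%O /\ f z y != 0] `|`
          [set z | (x <= z)%O /\ g z y != 0].
have finS : finite_set S by rewrite finite_setU; split; exact: finite_col.
rewrite !(@conv_sub_col _ _ _ _ S) //.
- rewrite !fsbig_finite //= -big_split /=; apply: eq_bigr => z _.
  by rewrite -mulrDr.
- by move=> z ?; right.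
- by move=> z ?; left.
- move=> z [xz]; rewrite fincidenceDE incidenceDE => fgz.
  case: (eqVneq (f z y) 0) => [f0|fn0]; last by left.
  by right; split=> //; rewrite f0 add0r in fgz.
Qed.

Definition diag_fun (c : X -> K) (x y : X) : K := c x *+ (x == y).

Lemma diag_incidence (c : X -> K) : diag_fun c \in incidence_pred.
Proof.
apply/asboolP => x y; apply: contraNeq; rewrite /diag_fun.
by case: (eqVneq x y) => [->|_]; rewrite ?lexx ?eqxx.
Qed.

Lemma diag_finitary (c : X -> K) :
  Incidence (diag_incidence c) \in finitary_pred.
Proof.
apply/asboolP => x y _; apply: (@sub_finite_set _ _ set0) => // p.
by case=> _ /lt_eqF pp _; rewrite /= /diag_fun pp eqxx.
Qed.

Definition diag (c : X -> K) : fincidence := Fincidence (diag_finitary c).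

Lemma diagE (c : X -> K) x y : diag c x y = c x *+ (x == y).
Proof. by []. Qed.

Definition idemp (x : X) : fincidence := diag (fun z => (z == x)%:R).

Lemma idempE (x u v : X) : idemp x u v = ((u == x) && (v == x))%:R.
Proof.
rewrite diagE; case: (eqVneq u v) => [->|]; first by rewrite andbb mulr1n.
by case: (eqVneq u x) => //= ->; rewrite eq_sym mulr0n => /negPf->.
Qed.

Lemma conv_diagl (c : X -> K) i x y : conv (diag c) i x y = c x * i x y.
Proof.
rewrite convE -(fsbig_widen [set x] setT) //.
  by rewrite fsbig_set1 diagE eqxx.
by move=> z [_ /eqP zx] /=; rewrite /diag_fun eq_sym (negPf zx) mul0r.
Qed.

Lemma conv_diagr (c : X -> K) i x y : conv i (diag c) x y = i x y * c y.
Proof.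
rewrite convE -(fsbig_widen [set y] setT) //.
  by rewrite fsbig_set1 diagE eqxx.
by move=> z [_ /eqP zy] /=; rewrite /diag_fun (negPf zy) mulr0.
Qed.

Lemma conv1l i : conv (diag (fun=> 1)) i = i.
Proof. by apply/incidenceP => x y; rewrite conv_diagl mul1r. Qed.

Lemma conv1r i : conv i (diag (fun=> 1)) = i.
Proof. by apply/incidenceP => x y; rewrite conv_diagr mulr1. Qed.

Lemma fmul_subproof f g : conv f g \in finitary_pred.
Proof.
apply/asboolP => x y xy.
pose F := off_diag f x y; pose G := off_diag g x y.
have finF : finite_set F by exact: fincidence_finite.
have finG : finite_set G by exact: fincidence_finite.
apply: (@sub_finite_set _ _
  (F `|` G `|` [set (q.1.1, q.2.2) | q in F `*` G])).
  move=> [u v] [/= xu uv vy] /conv_neq0[z fz gz].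
  have uz := incidence_in fz; have zv := incidence_in gz.
  case: (eqVneq z u) gz zv => [-> guv _|zu gz zv]; first by left; right.
  case: (eqVneq v z) fz uz => [-> fuz uz|vz fz uz].
    by left; left; split=> //=; rewrite ?(le_trans zv) // lt_def zu.
  right; exists ((u, z), (z, v)) => //; split; split=> //=.
  - by rewrite lt_def zu.
  - exact: le_trans zv vy.
  - exact: le_trans xu uz.
  - by rewrite lt_def vz.
rewrite !finite_setU; split; first by [].
by apply: finite_image; apply: finite_setX.
Qed.

Definition fmul f g : fincidence := Fincidence (fmul_subproof f g).

Lemma fmulA : associative fmul.
Proof. by move=> f g h; apply: val_inj; exact: conv_assoc_l. Qed.

Lemma fmul1l : left_id (diag (fun=> 1)) fmul.
Proof. by move=> f; apply: val_inj; exact: conv1l. Qed.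

Lemma fmul1r : right_id (diag (fun=> 1)) fmul.
Proof. by move=> f; apply: val_inj; exact: conv1r. Qed.

Lemma fmulDl : left_distributive fmul +%R.
Proof. by move=> f g h; apply: val_inj; exact: convDl_l. Qed.

Lemma fmulDr : right_distributive fmul +%R.
Proof. by move=> f g h; apply: val_inj; exact: convDr_l. Qed.

HB.instance Definition _ := GRing.Zmodule_isPzRing.Build fincidence
  fmulA fmul1l fmul1r fmulDl fmulDr.

Lemma fincidenceME f g : (f * g : fincidence) = conv f g :> incidence.
Proof. by []. Qed.

Lemma scale_fincidenceAl (k : K) f g : k *: (f * g) = (k *: f) * g.
Proof. by apply: val_inj; exact/esym/convZl. Qed.

Lemma scale_fincidenceAr (k : K) f g : k *: (f * g) = f * (k *: g).
Proof. by apply: val_inj; exact/esym/convZr. Qed.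

Definition idealization : Type := (fincidence * incidence)%type.

HB.instance Definition _ :=
  GRing.Lmodule.copy idealization (fincidence * incidence)%type.

Implicit Types (a b c : idealization).

Definition imul a b : idealization :=
  (a.1 * b.1, conv a.1 b.2 + conv a.2 b.1).

Definition ione : idealization := (1, 0).

Lemma conv0l i : conv 0 i = 0.
Proof. by apply/incidenceP => x y; rewrite convE fsbig1 // => z _; exact: mul0r. Qed.

Lemma conv0r i : conv i 0 = 0.
Proof. by apply/incidenceP => x y; rewrite convE fsbig1 // => z _; exact: mulr0. Qed.

Lemma imulA : associative imul.
Proof.
case=> [f i] [g j] [h k]; rewrite /imul /=; congr (_, _); first exact: mulrA.
rewrite convDr_l convDl_r conv_assoc_l conv_assoc_m conv_assoc_r.
by rewrite addrA.
Qed.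

Lemma imul1l : left_id ione imul.
Proof.
by case=> [f i]; rewrite /imul /= mul1r conv0l conv1l addr0.
Qed.

Lemma imul1r : right_id ione imul.
Proof.
by case=> [f i]; rewrite /imul /= mulr1 conv0r conv1r add0r.
Qed.

Lemma imulDl : left_distributive imul +%R.
Proof.
case=> [f i] [g j] [h k]; rewrite /imul /=; congr (_, _); first exact: mulrDl.
by rewrite convDl_l convDl_r addrACA.
Qed.

Lemma imulDr : right_distributive imul +%R.
Proof.
case=> [f i] [g j] [h k]; rewrite /imul /=; congr (_, _); first exact: mulrDr.
by rewrite convDr_l convDr_r addrACA.
Qed.

HB.instance Definition _ := GRing.Zmodule_isPzRing.Build idealization
  imulA imul1l imul1r imulDl imulDr.

Lemma scale_idealizationAl (k : K) a b : k *: (a * b) = (k *: a) * b.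
Proof.
case: a b => [f i] [g j]; congr (_, _); first exact: scale_fincidenceAl.
by rewrite [LHS]scalerDr -!convZl.
Qed.

Lemma scale_idealizationAr (k : K) a b : k *: (a * b) = a * (k *: b).
Proof.
case: a b => [f i] [g j]; congr (_, _); first exact: scale_fincidenceAr.
by rewrite [LHS]scalerDr -!convZr.
Qed.

Definition iidemp (x : X) : idealization := (idemp x, 0).

Definition blockop (p11 : fincidence -> fincidence)
    (p12 : incidence -> fincidence) (p21 : fincidence -> incidence)
    (p22 : incidence -> incidence) (a : idealization) : idealization :=
  (p11 a.1 + p12 a.2, p21 a.1 + p22 a.2).

(* At most one sigma satisfies this when rho is an anti-automorphism.          *)
Definition bar_extension (rho : fincidence -> fincidence)
    (sigma : incidence -> incidence) : Prop :=
  [/\ bijective sigma,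
      forall i j, sigma (i + j) = sigma i + sigma j,
      forall f, sigma f = rho f
    & forall f i h,
        sigma (conv (conv f i) h) = conv (conv (rho h) (sigma i)) (rho f)].

Definition tilde_antiaut (rho : fincidence -> fincidence)
    (sigma : incidence -> incidence) : idealization -> idealization :=
  blockop rho (fun=> 0) (fun=> 0) sigma.

Definition tilde_unit (g : fincidence) (a : idealization) : idealization :=
  (a.1, conv g a.2).

Definition tilde_der (D : fincidence -> incidence) (a : idealization) :
    idealization :=
  (a.1, D a.1 + a.2).

Definition derivation (D : fincidence -> incidence) : Prop :=
  forall f h, D (f * h) = conv (D f) h + conv f (D h).

End Incidence.

Arguments incidence K {d} X.
Arguments fincidence K {d} X.
Arguments idealization K {d} X.
Arguments idemp K {d X} x.
Arguments iidemp K {d X} x.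

Section Rings.
Context (R : pzRingType).

Definition is_inverse (u v : R) : Prop := u * v = 1 /\ v * u = 1.

Definition central_unit (g : R) : Prop :=
  (forall f, g * f = f * g) /\ exists g', is_inverse g g'.

Definition conjugate (a b : R) : Prop :=
  exists u v, is_inverse u v /\ a = u * b * v.

(* K-linearity is not included here: phi is to be a {linear _ -> _}.          *)
Definition antiaut (phi : R -> R) : Prop :=
  bijective phi /\ forall a b, phi (a * b) = phi b * phi a.

Definition involution (phi : R -> R) : Prop := antiaut phi /\ involutive phi.

End Rings.

Definition poset_antiaut d (X : porderType d) (lam : X -> X) : Prop :=
  bijective lam /\ forall x y, (lam x <= lam y)%O = (y <= x)%O.

(* e is the family of the idempotents e_x in R; the equivalence includes the  *)
(* uniqueness of lam x.                                                       *)
Definition induces (R : pzRingType) d (X : porderType d) (e : X -> R)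
    (phi : R -> R) (lam : X -> X) : Prop :=
  poset_antiaut lam /\ forall x y, conjugate (phi (e x)) (e y) <-> y = lam x.

(* Main.v *)
From HB Require Import structures.
Require Import Defs.
From mathcomp Require Import all_boot all_order all_algebra.
From mathcomp Require Import finmap.
From mathcomp Require Import boolp classical_sets cardinality fsbigop.

Set Implicit Arguments.
Unset Strict Implicit.
Unset Printing Implicit Defensive.

Import Order.TTheory GRing.Theory.
Local Open Scope ring_scope.

(** Let [w = phi22 1], where [1] is the unit of [FI] seen in [I]. That [Phi] is
    anti-multiplicative says that [rho] is so too, that [phi22] reverses the
    bimodule structure of [I] along [rho], and that [phi21] is a derivation
    twisted by [rho]. Hence [phi22 f = w * rho f = rho f * w] for [f] in [FI];
    since [rho] is onto, [w] commutes with [FI], so it is diagonal and constant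
    on comparable elements, and since [phi22] is injective its diagonal does not
    vanish. Thus [w] is a central unit, and the decomposition can be written
    down: [w^-1 * phi22] is the extension of [rho] to [I], [g] is the preimage
    of [w] under [rho], and [D] is [phi22^-1 \o phi21]
    ([phi22_one], [phi22_convl], [phi22_convr], [phi21M]).

    The induced anti-automorphism of the poset comes from the idempotents. An
    idempotent of [FI] with zero diagonal vanishes ([idem_diag0]), so
    [a = rho e_x] has a nonzero diagonal entry, at [y] say; as [a FI a = K a],
    the idempotents [a] and [e_y] are isomorphic, and an explicit unit
    conjugates them ([conjugate_idem]). The order is recovered from
    [x <= y <-> e_x FI e_y <> 0]. Finally, an idempotent of [D(X,K)] is
    conjugate to [(e_y, 0)] as soon as its first component is conjugate to
    [e_y] ([conjugate_iidemp]), so that every anti-automorphism of [D(X,K)]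
    with first component [rho] induces the same map on the poset. *)

(** * Conjugacy in rings *)

Section RingLemmas.
Context (R : pzRingType).
Implicit Types (a b p q u v : R).

Lemma is_inverse_uniq u v v' : u * v = 1 -> v' * u = 1 -> is_inverse u v.
Proof.
by move=> uv vu; split=> //; rewrite -[v]mul1r -{1}vu -(mulrA v') uv mulr1.
Qed.

Lemma is_inverseM u v u' v' :
  is_inverse u v -> is_inverse u' v' -> is_inverse (u * u') (v' * v).
Proof.
move=> [uv vu] [uv' vu']; split.
  by rewrite mulrA -(mulrA u) uv' mulr1.
by rewrite mulrA -(mulrA v') vu mulr1.
Qed.

Lemma conjugate_sym a b : conjugate a b -> conjugate b a.
Proof.
move=> [u [v [[uv vu] ->]]]; exists v, u; split; first by split.
by rewrite !mulrA vu mul1r -mulrA vu mulr1.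
Qed.

Lemma conjugate_trans b a c : conjugate a b -> conjugate b c -> conjugate a c.
Proof.
move=> [u [v [uv ->]]] [u' [v' [uv' ->]]].
by exists (u * u'), (v' * v); split; [exact: is_inverseM|rewrite !mulrA].
Qed.

Lemma idem_subr_sqr p q : p * p = p -> q * q = q ->
  (p - q) ^+ 2 = p - p * q - q * p + q.
Proof.
by move=> pp qq; rewrite expr2 mulrBl !mulrBr pp qq opprB addrA addrAC.
Qed.

(** The element [p q + (1 - p)(1 - q)] intertwines [p] and [q], and its product
    with [q p + (1 - q)(1 - p)], in either order, is [1 - (p - q) ^+ 2], which
    is invertible when [(p - q) ^+ 2] squares to zero. *)
Lemma conjugate_idem p q : p * p = p -> q * q = q ->
  (p - q) ^+ 2 * (p - q) ^+ 2 = 0 -> conjugate p q.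
Proof.
pose U a b := a * b + (1 - a) * (1 - b).
have UE a b : a * a = a -> b * b = b -> U a b * U b a = 1 - (a - b) ^+ 2.
  move=> aa bb.
  have b'b : (1 - b) * b = 0 by rewrite mulrBl mul1r bb subrr.
  have bb' : b * (1 - b) = 0 by rewrite mulrBr mulr1 bb subrr.
  have b'b' : (1 - b) * (1 - b) = 1 - b by rewrite mulrBl mul1r bb' subr0.
  have a'a' : (1 - a) * (1 - a) = 1 - a.
    by rewrite mulrBl mul1r mulrBr mulr1 aa subrr subr0.
  have a'ba' : (1 - a) * (b * (1 - a)) = b - a * b - b * a + a * (b * a).
    rewrite mulrBl mul1r !mulrBr !mulr1 opprB addrA addrAC.
    by rewrite [b - _ - _]addrAC.
  rewrite /U mulrDl [X in X + _]mulrDr [X in _ + X]mulrDr.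
  rewrite -!mulrA [b * (b * a)]mulrA bb.
  rewrite [b * ((1 - b) * _)]mulrA bb' mul0r mulr0 addr0.
  rewrite [(1 - b) * (b * a)]mulrA b'b mul0r mulr0 add0r.
  rewrite [(1 - b) * ((1 - b) * _)]mulrA b'b'.
  rewrite [(1 - b) * (1 - a)]mulrBl mul1r mulrBr a'a' a'ba' idem_subr_sqr //.
  rewrite opprD (addrA (1 - a)) [LHS]addrC subrK -addrA -opprD; congr (1 - _).
  by rewrite -[b - _ - _]addrA [b + _]addrC !addrA.
move=> pp qq; have pq2 : (q - p) ^+ 2 = (p - q) ^+ 2.
  by rewrite -opprB sqrrN.
have := UE _ _ qq pp; have := UE _ _ pp qq; rewrite pq2.
set c := (p - q) ^+ 2 => uv vu cc.
have cK : (1 - c) * (1 + c) = 1.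
  by rewrite mulrBl mul1r mulrDr mulr1 cc addr0 addrK.
have Kc : (1 + c) * (1 - c) = 1.
  by rewrite mulrDl mul1r mulrBr mulr1 cc subr0 subrK.
have uK : is_inverse (U p q) (U q p * (1 + c)).
  apply: (@is_inverse_uniq _ _ ((1 + c) * U q p)).
    by rewrite mulrA uv.
  by rewrite -mulrA vu.
have Up : U p q * q = p * U p q.
  have -> : U p q * q = p * q.
    rewrite /U mulrDl -!mulrA qq [(1 - q) * q]mulrBl mul1r qq subrr.
    by rewrite mulr0 addr0.
  by rewrite /U mulrDr !mulrA pp [p * (1 - p)]mulrBr mulr1 pp subrr mul0r addr0.
exists (U p q), (U q p * (1 + c)); split=> //.
by rewrite Up -mulrA uK.1 mulr1.
Qed.

(** Here [p * q] and [q * p] are mutually inverse isomorphisms between [p] and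
    [q], and [p] and [q] both annihilate [(p - q) ^+ 2] from the left. *)
Lemma conjugate_idem_iso p q :
  p * p = p -> q * q = q -> p * q * p = p -> q * p * q = q -> conjugate p q.
Proof.
move=> pp qq pqp qpq; apply: conjugate_idem => //.
have pc : p * (p - q) ^+ 2 = 0.
  rewrite idem_subr_sqr // mulrDr !mulrBr !mulrA pp pqp.
  by rewrite addrAC subrK subrr.
have qc : q * (p - q) ^+ 2 = 0.
  rewrite idem_subr_sqr // mulrDr !mulrBr !mulrA qq qpq.
  by rewrite addrAC subrK subrr.
by rewrite {1}expr2 -mulrA [(p - q) * (_ ^+ 2)]mulrBl pc qc subrr mulr0.
Qed.


Lemma conjugate_idem_l p q : conjugate p q -> q * q = q -> p * p = p.
Proof.
move=> [u [v [[_ vu] ->]]] qq.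
by rewrite -!mulrA (mulrA v) vu mul1r (mulrA q) qq.
Qed.

Lemma antiaut1 (phi : R -> R) : antiaut phi -> phi 1 = 1.
Proof.
move=> [[psi _ psiK] phiM].
by rewrite -[LHS]mulr1 -{2}[1]psiK -phiM mulr1 psiK.
Qed.

Lemma antiaut0 (phi : R -> R) : antiaut phi -> phi 0 = 0.
Proof.
move=> [[psi _ psiK] phiM].
by rewrite -[X in phi X](mulr0 (psi 0)) phiM psiK mulr0.
Qed.

Lemma antiaut_inv (phi psi : R -> R) :
  antiaut phi -> cancel phi psi -> cancel psi phi -> antiaut psi.
Proof.
move=> [_ phiM] phiK psiK; split; first by exists phi.
by move=> a b; rewrite -[RHS]phiK; congr psi; rewrite phiM !psiK.
Qed.

Lemma conjugate_antiaut (phi : R -> R) a b :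
  antiaut phi -> conjugate a b -> conjugate (phi a) (phi b).
Proof.
move=> phiA [u [v [[uv vu] ->]]]; have [_ phiM] := phiA.
exists (phi v), (phi u); split; last by rewrite !phiM mulrA.
by split; rewrite -phiM ?uv ?vu; exact: antiaut1.
Qed.

(** Two elements are linked if [a R b] is nonzero. For the idempotents [e_x] of
    an incidence algebra, this recovers the order of the
    poset from the multiplication. *)
Definition linked a b : Prop := exists r, a * r * b <> 0.

Lemma linked_conjugate a a' b b' :
  conjugate a a' -> conjugate b b' -> linked a b -> linked a' b'.
Proof.
move=> [u [v [_ ->]]] [s [t [_ ->]]] [r arb]; exists (v * r * s) => arb0.
apply: arb; transitivity (u * (a' * (v * r * s) * b') * t).
  by rewrite !mulrA.
by rewrite arb0 mulr0 mul0r.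
Qed.

Lemma linked_antiaut (phi : R -> R) a b :
  antiaut phi -> linked (phi a) (phi b) <-> linked b a.
Proof.
move=> phiA; have [[psi phiK psiK] phiM] := phiA.
split=> [] [r ab].
  exists (psi r) => ba; apply: ab.
  by rewrite -[r]psiK -mulrA -!phiM ba antiaut0.
exists (phi r) => ba; apply: ab; apply: (can_inj phiK).
by rewrite !phiM mulrA ba antiaut0.
Qed.

End RingLemmas.

(** * Idempotents of the finitary incidence algebra *)

Section IncidenceLemmas.
Context (K : fieldType) (d : Order.disp_t) (X : porderType d).
Implicit Types (f g h : fincidence K X) (i j : incidence K X) (x y z : X).

Lemma fincidence1E x y : (1 : fincidence K X) x y = (x == y)%:R.
Proof. by []. Qed.

Lemma fmul_diag f g x : (f * g) x x = f x x * g x x.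
Proof.
rewrite fincidenceME convE -(fsbig_widen [set x]%classic setT) ?fsbig_set1 //.
move=> z [_ /= zx]; apply/eqP; rewrite mulf_eq0; apply: contra_notT zx.
rewrite negb_or => /andP[/incidence_in xz /incidence_in zx].
by apply/esym/le_anti; rewrite xz zx.
Qed.

Lemma idempM x : idemp K x * idemp K x = idemp K x.
Proof.
apply/fincidenceP => u v; rewrite fincidenceME conv_diagl idempE.
by case: eqP => _; rewrite ?mul1r ?mul0r.
Qed.

Lemma idemp_sandwich x y f u v :
  (idemp K x * f * idemp K y) u v = (u == x)%:R * f u v * (v == y)%:R.
Proof. by rewrite fincidenceME conv_diagr fincidenceME conv_diagl. Qed.

Lemma idemp_corner x f : idemp K x * f * idemp K x = f x x *: idemp K x.
Proof.
apply/fincidenceP => u v; rewrite idemp_sandwich.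
rewrite fincidenceZE incidenceZE idempE.
case: (eqVneq u x) => [->|_]; last by rewrite !mul0r mulr0.
case: (eqVneq v x) => [->|_]; last by rewrite !mulr0.
by rewrite mul1r.
Qed.

Definition mxunit_fun x y (u v : X) : K :=
  [&& u == x, v == y & (x <= y)%O]%:R.

Lemma mxunit_incidence x y : mxunit_fun x y \in @incidence_pred K d X.
Proof.
apply/asboolP => u v; apply: contraNeq; rewrite /mxunit_fun.
by case: and3P => [[/eqP-> /eqP->]|]; rewrite ?eqxx.
Qed.

Lemma mxunit_finitary x y :
  Incidence (mxunit_incidence x y) \in @finitary_pred K d X.
Proof.
apply/asboolP => s t _; apply: (@sub_finite_set _ _ [set (x, y)]%classic) => //.
move=> [u v] [/= _ _ _]; rewrite /mxunit_fun.
by case: and3P => [[/eqP-> /eqP->]|]; rewrite ?eqxx.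
Qed.

(** The matrix unit at [(x, y)] if [x <= y], and [0] otherwise. *)
Definition mxunit x y : fincidence K X := Fincidence (mxunit_finitary x y).

Lemma mxunitE x y u v : mxunit x y u v = [&& u == x, v == y & (x <= y)%O]%:R.
Proof. by []. Qed.

Lemma linked_idemp x y : linked (idemp K x) (idemp K y) <-> (x <= y)%O.
Proof.
split=> [[r rxy]|xy].
  case: (boolP (x <= y)%O) => // nxy; case: rxy; apply/fincidenceP => u v.
  rewrite idemp_sandwich [RHS]incidence0E.
  case: (eqVneq u x) => [->|_]; last by rewrite !mul0r.
  case: (eqVneq v y) => [->|_]; last by rewrite mulr0.
  by rewrite incidence_out // mulr0 mul0r.
exists (mxunit x y) => /fincidenceP/(_ x y)/eqP.
rewrite idemp_sandwich mxunitE !eqxx xy !mulr1.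
by rewrite [X in _ == X]incidence0E oner_eq0.
Qed.

(** A nonzero value at [(x, y)] would produce a nonzero value at some
    [(x, z)] with [x < z < y], and [[x, z]] contains strictly fewer of
    the finitely many pairs in the support. *)
Lemma idem_diag0 f : f * f = f -> (forall x, f x x = 0) -> f = 0.
Proof.
move=> ff f0; apply/fincidenceP => x y; rewrite [RHS]incidence0E.
have [n] := ubnP (size (fset_set (off_diag f x y))).
elim: n y => // n IHn y; rewrite ltnS => le_n.
apply/eqP; apply: contraT => fxy; have xy := incidence_in fxy.
have := fxy; rewrite -ff fincidenceME => /conv_neq0[z fxz fzy].
have xz := incidence_in fxz; have zy := incidence_in fzy.
have ltzy : (z < y)%O.
  by rewrite lt_def zy andbT; apply: contraNneq fzy => ->; rewrite f0.
case/eqP: fxz; apply: IHn; apply: leq_trans le_n.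
apply: fproper_ltn_card; rewrite fproperE; apply/andP; split.
  apply/fsubsetP => p; rewrite !in_fset_set; try exact: fincidence_finite.
  move=> /set_mem[xp pp pz fp]; apply/mem_set; split=> //.
  exact: le_trans pz zy.
apply/fsubsetPn; exists (z, y).
  rewrite in_fset_set; last exact: fincidence_finite.
  by apply/mem_set; split.
rewrite in_fset_set; last exact: fincidence_finite.
by apply/negP => /set_mem[_ _ /= /(lt_le_trans ltzy)]; rewrite ltxx.
Qed.

Lemma conjugate_idemp_diag f y z :
  conjugate f (idemp K y) -> f z z = (z == y)%:R.
Proof.
move=> [u [v [[uv _] ->]]]; rewrite !fmul_diag idempE andbb mulrAC.
by rewrite -fmul_diag uv fincidence1E eqxx mul1r.
Qed.

Lemma conjugate_idemp_inj f y z :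
  conjugate f (idemp K y) -> conjugate f (idemp K z) -> y = z.
Proof.
move=> /(conjugate_idemp_diag y); rewrite eqxx => fy /(conjugate_idemp_diag y).
by rewrite fy; case: eqP => // _ /eqP; rewrite oner_eq0.
Qed.

(** The image [a] of [e_x] is a nonzero idempotent with [a FI a = K a], so some
    diagonal entry [a y y] is nonzero; then [a] and [e_y] are isomorphic
    idempotents. *)
Lemma antiaut_idemp_conjugate (phi : fincidence K X -> fincidence K X) x :
    antiaut phi -> scalable phi ->
  exists y, conjugate (phi (idemp K x)) (idemp K y).
Proof.
move=> phiA phiZ; have [[psi phiK psiK] phiM] := phiA.
set a := phi _; have aa : a * a = a by rewrite -phiM idempM.
have afa f : a * f * a = psi f x x *: a.
  by rewrite -phiZ -idemp_corner !phiM psiK mulrA.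
have [y ay] : exists y, a y y <> 0.
  apply: contrapT => /forallNP a0; have : a = 0.
    by apply: idem_diag0 => // y; apply: contrapT; exact: a0.
  rewrite -(antiaut0 phiA) => /(can_inj phiK)/fincidenceP/(_ x x)/eqP.
  by rewrite idempE eqxx [X in _ == X]incidence0E oner_eq0.
have ay1 : a y y = 1.
  apply: (mulfI (introN eqP ay)); rewrite mulr1 -fmul_diag aa //.
exists y; apply: conjugate_idem_iso; rewrite ?idempM //.
  have := fincidenceP (a * idemp K y * a) (psi (idemp K y) x x *: a).
  move=> [_ /(_ (afa _))/(_ y y)].
  rewrite !fmul_diag idempE eqxx !mulr1 ay1 fincidenceZE incidenceZE ay1 !mulr1.
  by rewrite afa => <-; rewrite scale1r.
by rewrite idemp_corner ay1 scale1r.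
Qed.

(** The induced map is bijective because the inverse of [phi] induces its
    inverse; it is order-reversing because [x <= y] says that [e_x] and [e_y]
    are linked. *)
Lemma antiaut_induces (phi : fincidence K X -> fincidence K X) :
  antiaut phi -> scalable phi -> exists lam, induces (idemp K) phi lam.
Proof.
move=> phiA phiZ; have [[psi phiK psiK] _] := phiA.
have psiA := antiaut_inv phiA phiK psiK.
have psiZ : scalable psi.
  by move=> k f; rewrite -[RHS]phiK; congr psi; rewrite phiZ !psiK.
have [lam lamP] := choice (fun x => antiaut_idemp_conjugate x phiA phiZ).
have [mu muP] := choice (fun x => antiaut_idemp_conjugate x psiA psiZ).
have lam_le x y : (lam x <= lam y)%O = (y <= x)%O.
  have [phi_linked linked_phi] := linked_antiaut (idemp K x) (idemp K y) phiA.
  apply/idP/idP => /linked_idemp le_xy; apply/linked_idemp.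
    apply: phi_linked; apply: linked_conjugate le_xy.
      exact: conjugate_sym (lamP x).
    exact: conjugate_sym (lamP y).
  exact: linked_conjugate (lamP x) (lamP y) (linked_phi le_xy).
have muK : cancel mu lam.
  move=> y; apply: (@conjugate_idemp_inj (phi (idemp K (mu y)))) => //.
  apply: conjugate_sym; rewrite -{1}[idemp K y]psiK.
  exact: conjugate_antiaut.
have lam_inj : injective lam.
  by move=> x y xy; apply/le_anti/andP; split; rewrite -lam_le xy.
exists lam; split.
  by split=> //; exists mu => // x; apply: lam_inj; rewrite muK.
move=> x y; split=> [xy|->]; last exact: lamP.
exact: conjugate_idemp_inj xy (lamP x).
Qed.

(** * Idempotents of the idealization *)

Lemma idealizationME (a b : idealization K X) :
  a * b = (a.1 * b.1, conv a.1 b.2 + conv a.2 b.1) :> idealization K X.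
Proof. by []. Qed.

Lemma conjugate_fst (a b : idealization K X) :
  conjugate a b -> conjugate a.1 b.1.
Proof.
by move=> [u [v [[/(congr1 fst)/= uv /(congr1 fst)/= vu] ->]]];
  exists u.1, v.1.
Qed.

(** After conjugation by units of [FI], [p] and [e_y] have the same first
    component, so that their difference squares to zero. *)
Lemma conjugate_iidemp (p : idealization K X) y : p * p = p ->
  conjugate p (iidemp K y) <-> conjugate p.1 (idemp K y).
Proof.
move=> pp; split=> [/conjugate_fst //|p1y].
have [u [v [[uv vu] ep]]] := conjugate_sym p1y.
pose U : idealization K X := (u, 0); pose V : idealization K X := (v, 0).
pose q := U * p * V.
have pq : conjugate q p.
  exists U, V; split=> //.
  by split; rewrite idealizationME /= ?uv ?vu conv0r conv0l addr0.
apply: conjugate_trans (conjugate_sym pq) _; apply: conjugate_idem.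
- exact: conjugate_idem_l pq pp.
- by rewrite idealizationME /= idempM conv0r conv0l addr0.
suff -> : (q - iidemp K y) ^+ 2 = 0 by rewrite mulr0.
have qy0 : (q - iidemp K y).1 = 0 by rewrite /= -ep subrr.
by rewrite expr2 idealizationME qy0 mul0r conv0l conv0r addr0.
Qed.

Lemma induces_idealization (rho : fincidence K X -> fincidence K X)
    (Psi : idealization K X -> idealization K X) lam :
    induces (idemp K) rho lam ->
    (forall x, (Psi (iidemp K x)).1 = rho (idemp K x)) ->
    (forall x, Psi (iidemp K x) * Psi (iidemp K x) = Psi (iidemp K x)) ->
  induces (iidemp K) Psi lam.
Proof.
move=> [lamA lamP] Psi1 PsiM; split=> // x y.
by rewrite -lamP -Psi1; exact: conjugate_iidemp.
Qed.

(** * Central elements of the incidence space *)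

(** Commuting with each [e_x] forces [i] to be diagonal; commuting with the
    matrix unit at [(x, y)] forces [i x x = i y y]. *)
Lemma conv_central_diag i : (forall f, conv f i = conv i f) ->
  exists2 c : X -> K, i = diag c & forall x y, (x <= y)%O -> c x = c y.
Proof.
move=> ci; exists (fun x => i x x).
  apply/incidenceP => x y; rewrite diagE.
  have /incidenceP/(_ x y) := ci (idemp K x).
  rewrite conv_diagl conv_diagr eqxx mul1r => ->.
  by rewrite eq_sym; case: eqP => [->|_]; rewrite ?mulr1 ?mulr0 ?mulr0n.
move=> x y xy; have /incidenceP/(_ x y) := ci (mxunit x y).
rewrite !convE -(fsbig_widen [set y]%classic setT) //; last first.
  move=> z [_ /= /eqP/negPf zy]; change (mxunit x y x z * i z y = 0).
  by rewrite mxunitE zy andbF mul0r.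
rewrite -(fsbig_widen [set x]%classic setT) //; last first.
  move=> z [_ /= /eqP/negPf zx]; change (i x z * mxunit x y z y = 0).
  by rewrite mxunitE zx mulr0.
by rewrite !fsbig_set1 !mxunitE !eqxx xy mul1r mulr1.
Qed.

Lemma conv_diag_comm (c : X -> K) i :
    (forall x y, (x <= y)%O -> c x = c y) ->
  conv (diag c) i = conv i (diag c).
Proof.
move=> cE; apply/incidenceP => x y; rewrite conv_diagl conv_diagr mulrC.
by have [/cE->|/incidence_out->] := boolP (x <= y)%O; rewrite ?mul0r.
Qed.

End IncidenceLemmas.

(** * Anti-automorphisms of the idealization *)

Lemma linear_inverse (R : pzRingType) (U V : lmodType R)
    (f : {linear U -> V}) (f' : V -> U) :
  cancel f f' -> cancel f' f -> exists g : {linear V -> U}, g =1 f'.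
Proof.
move=> fK f'K; have f'_lin : linear f'.
  by move=> k u v; apply: (can_inj fK); rewrite linearP !f'K.
pose f'M := GRing.isLinear.Build R V U *:%R f' f'_lin.
by exists (HB.pack_for {linear V -> U} f' f'M).
Qed.

Section LowerTriangular.
Context (K : fieldType) (d : Order.disp_t) (X : porderType d).
Context (Phi : {linear idealization K X -> idealization K X})
  (rho : {linear fincidence K X -> fincidence K X})
  (phi21 : {linear fincidence K X -> incidence K X})
  (phi22 : {linear incidence K X -> incidence K X})
  (PhiE : Phi =1 blockop rho (fun=> 0) phi21 phi22)
  (Phi_antiaut : antiaut Phi).
Implicit Types (f g h : fincidence K X) (i j : incidence K X) (x y z : X).

(* The bimodule [I] carries no multiplication: its [1] is that of [FI]. *)
Let one : incidence K X := (1 : fincidence K X).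

Let conv1i i : conv one i = i. Proof. exact: conv1l. Qed.
Let convi1 i : conv i one = i. Proof. exact: conv1r. Qed.

Lemma lowerE f i : Phi (f, i) = (rho f, phi21 f + phi22 i).
Proof. by rewrite PhiE /blockop /= addr0. Qed.

Lemma rhoM f g : rho (f * g) = rho g * rho f.
Proof.
have /(congr1 fst) := Phi_antiaut.2 (f, 0) (g, 0).
by rewrite !idealizationME !lowerE.
Qed.

Lemma lowerM_snd f i g j :
  phi21 (f * g) + phi22 (conv f j + conv i g) =
  conv (rho g) (phi21 f + phi22 i) + conv (phi21 g + phi22 j) (rho f).
Proof.
have /(congr1 snd) := Phi_antiaut.2 (f, i) (g, j).
by rewrite !idealizationME !lowerE.
Qed.

Lemma phi21M f g :
  phi21 (f * g) = conv (rho g) (phi21 f) + conv (phi21 g) (rho f).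
Proof.
have := lowerM_snd f 0 g 0.
by rewrite conv0r conv0l addr0 !(linear0 phi22) !addr0.
Qed.

Lemma phi22_convl f i : phi22 (conv f i) = conv (phi22 i) (rho f).
Proof.
have := lowerM_snd f 0 0 i.
rewrite mulr0 (linear0 phi21) (linear0 rho) (linear0 phi22) conv0l.
by rewrite [conv (0 : fincidence K X) _]conv0l !add0r addr0.
Qed.

Lemma phi22_convr i f : phi22 (conv i f) = conv (rho f) (phi22 i).
Proof.
have := lowerM_snd 0 i f 0.
rewrite mul0r (linear0 phi21) (linear0 rho) (linear0 phi22) conv0r.
by rewrite [conv _ (0 : fincidence K X)]conv0r !add0r addr0.
Qed.

(** If [rho f = 0], then [Phi (f, 0)] lies in the square-zero ideal
    [0 (+) I], which annihilates the image of [(0, 1)]; hence [f 1 = 0]. *)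
Lemma rho_inj : injective rho.
Proof.
suff rho0 f : rho f = 0 -> f = 0.
  move=> f g fg; apply/eqP; rewrite -subr_eq0 (rho0 (f - g)) //.
  by rewrite linearB fg subrr.
move=> f0; have := phi22_convl f one; rewrite convi1 f0 [conv _ 0]conv0r => f22.
have := bij_inj Phi_antiaut.1 (x1 := (0, f : incidence K X)) (x2 := 0).
rewrite lowerE f22 !linear0 addr0 => /(_ erefl)[ef].
by apply: val_inj.
Qed.

Lemma phi22_inj : injective phi22.
Proof.
move=> i j ij; have := bij_inj Phi_antiaut.1 (x1 := (0, i)) (x2 := (0, j)).
by rewrite !lowerE ij => /(_ erefl)[].
Qed.

Lemma rho_bij : bijective rho.
Proof.
have [Psi _ PsiK] := Phi_antiaut.1.
have rhoK : cancel (fun f => (Psi (f, 0)).1) rho.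
  by move=> f; have := PsiK (f, 0); case: (Psi _) => g j; rewrite lowerE => -[].
by exists (fun f => (Psi (f, 0)).1) => // f; apply: rho_inj; rewrite rhoK.
Qed.

Lemma phi22_bij : bijective phi22.
Proof.
have [Psi _ PsiK] := Phi_antiaut.1.
have phi22K : cancel (fun i => (Psi (0, i)).2) phi22.
  move=> i; have := PsiK (0, i); case: (Psi _) => g j; rewrite lowerE => -[g0].
  have -> : g = 0 by apply: rho_inj; rewrite g0 linear0.
  by rewrite linear0 add0r.
by exists (fun i => (Psi (0, i)).2) => // i; apply: phi22_inj; rewrite phi22K.
Qed.

Lemma rho_antiaut : antiaut rho.
Proof. by split; [exact: rho_bij|exact: rhoM]. Qed.

Lemma phi22_val f :
  phi22 f = conv (phi22 one) (rho f) /\ phi22 f = conv (rho f) (phi22 one).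
Proof. by rewrite -phi22_convl -phi22_convr conv1i convi1. Qed.

(** The element [phi22 1] commutes with the image of [rho], which is all of
    [FI]; if its diagonal vanished at [x], [phi22] would kill the preimage of
    [e_x] under [rho]. *)
Lemma phi22_one : exists c : X -> K,
  [/\ phi22 one = diag c, forall x y, (x <= y)%O -> c x = c y
    & forall x, c x != 0].
Proof.
have [sigma _ sigmaK] := rho_bij.
have [|c wE cE] := @conv_central_diag K d X (phi22 one).
  by move=> f; have [] := phi22_val (sigma f); rewrite sigmaK => -> ->.
exists c; split=> // x; apply/eqP => cx0.
have [+ _] := phi22_val (sigma (idemp K x)).
rewrite sigmaK wE => ex0; have : sigma (idemp K x) = 0.
  apply: val_inj; apply: phi22_inj; rewrite [LHS]ex0 linear0.
  apply/incidenceP => u v; rewrite conv_diagl idempE [RHS]incidence0E.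
  by case: eqP => [->|_]; rewrite ?cx0 ?mul0r ?mulr0.
move/(congr1 rho); rewrite sigmaK linear0 => /fincidenceP/(_ x x)/eqP.
by rewrite idempE eqxx [X in _ == X]incidence0E oner_eq0.
Qed.

End LowerTriangular.

Theorem theorem5p2 (K : fieldType) (d : Order.disp_t) (X : porderType d)
    (Phi : {linear idealization K X -> idealization K X})
    (rho : {linear fincidence K X -> fincidence K X})
    (phi21 : {linear fincidence K X -> incidence K X})
    (phi22 : {linear incidence K X -> incidence K X})
    (PhiE : Phi =1 blockop rho (fun=> 0) phi21 phi22)
    (Phi_antiaut : antiaut Phi) :
  [/\ antiaut rho,
      exists (rhobar : incidence K X -> incidence K X) (g : fincidence K X)
             (D : {linear fincidence K X -> incidence K X}) (lam : X -> X),
        [/\ bar_extension rho rhobar,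
            central_unit g,
            derivation D,
            Phi =1 tilde_antiaut rho rhobar \o tilde_unit g \o tilde_der D
          & [/\ induces (iidemp K) Phi lam,
                induces (idemp K) rho lam
              & induces (iidemp K) (tilde_antiaut rho rhobar) lam]]
    & involution Phi -> involution rho].
Proof.
have rhoA := rho_antiaut PhiE Phi_antiaut.
have rhoM := rhoA.2.
have phi22l := phi22_convl PhiE Phi_antiaut.
have phi22r := phi22_convr PhiE Phi_antiaut.
split=> //; last first.
  move=> [_ PhiK]; split=> // f; have := PhiK (f, 0).
  by rewrite !(lowerE PhiE) => -[].
have [sigma rhoK sigmaK] := rhoA.1.
have [tau phi22K tauK] := phi22_bij PhiE Phi_antiaut.
have [c [wE cE c0]] := phi22_one PhiE Phi_antiaut.
pose w := diag c; pose w' := diag (fun x => (c x)^-1).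
have wC i : conv w i = conv i w by exact: conv_diag_comm.
have w'C i : conv w' i = conv i w'.
  by apply: conv_diag_comm => x y /cE->.
have ww' : w * w' = 1.
  apply/fincidenceP => x y; rewrite fincidenceME conv_diagl diagE fincidence1E.
  by case: eqP => _; rewrite ?mulr0n ?mulr0 // mulr1n divff.
have w'w : w' * w = 1 by rewrite -ww'; apply: val_inj; exact: w'C.
have conv_w'w i : conv w' (conv w i) = i.
  by rewrite conv_assoc_l -fincidenceME w'w; exact: conv1l.
have conv_ww' i : conv w (conv w' i) = i.
  by rewrite conv_assoc_l -fincidenceME ww'; exact: conv1l.
have phi22w (f : fincidence K X) : phi22 f = conv w (rho f).
  by rewrite -wE; case: (phi22_val PhiE Phi_antiaut f).
have [tauL tauE] := linear_inverse phi22K tauK.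
pose D : {linear fincidence K X -> incidence K X} := tauL \o phi21.
have DE f : phi22 (D f) = phi21 f by rewrite /= tauE tauK.
pose rhobar i := conv w' (phi22 i).
have [lam lamP] := antiaut_induces rhoA (fun k => linearZ_LR rho k).
have idempD x : iidemp K x * iidemp K x = iidemp K x.
  by rewrite idealizationME /= idempM conv0r conv0l addr0.
exists rhobar, (sigma w), D, lam; split.
- split.
  + exists (fun i => tau (conv w i)) => i.
      by rewrite /rhobar conv_ww' phi22K.
    by rewrite /rhobar tauK conv_w'w.
  + by move=> i j; rewrite /rhobar linearD convDr_l.
  + by move=> f; rewrite /rhobar phi22w conv_w'w.
  + move=> f i h; rewrite /rhobar phi22r phi22l.
    rewrite conv_assoc_m (conv_assoc_m w'); congr conv.
    by rewrite conv_assoc_l w'C -conv_assoc_l.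
- split.
    move=> f; apply: (can_inj rhoK); rewrite !rhoM sigmaK; apply: val_inj.
    by rewrite /= wC.
  exists (sigma w'); split; apply: (can_inj rhoK);
    by rewrite rhoM !sigmaK (antiaut1 rhoA).
- move=> f h; apply: (can_inj phi22K).
  by rewrite linearD phi22l phi22r !DE (phi21M PhiE Phi_antiaut).
- move=> [f i]; rewrite (lowerE PhiE) /tilde_antiaut /blockop /= addr0 add0r.
  congr (_, _); rewrite /rhobar phi22l sigmaK -wC conv_w'w linearD.
  by rewrite DE.
- split=> //; apply: induces_idealization lamP _ _ => x.
  + by rewrite (lowerE PhiE).
  + by rewrite -Phi_antiaut.2 idempD.
  + by rewrite /tilde_antiaut /blockop /= addr0.
  + rewrite /tilde_antiaut /blockop /= addr0 add0r.
    have -> : rhobar 0 = 0 by rewrite /rhobar linear0 conv0r.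
    by rewrite idealizationME /= conv0r conv0l addr0 -rhoM idempM.
Qed.
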